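(* For $1\le\nu\le2$ and $0\le\rho<1$ let $$h(\rho,\nu)=\int_0^1\left[\frac{\rho}{1-\rho}\left(\frac{\rho u}{1-\rho}\right)^{\nu-1}(1-u)^{\frac1{1-\rho}}+\left(1+\frac{\rho u}{1-\rho}\right)^{\nu}(1-u)^{\frac1{1-\rho}-1}\right]du .$$ Then $$h(\rho,\nu)<1\qquad\text{for all } 1<\nu<2,\ 0\le\rho<1 .$$
   Context: The claim is a purely analytic statement about the function $h$ defined in it; no further notation is needed.
   Formalization: The formal theorem assumes 0 < ρ < 1 instead of 0 ≤ ρ < 1: at ρ = 0 the integrand is identically 1, so h(0,ν) = 1 for every ν and the strict inequality fails there. *)

(* Defs.v *)
From HB Require Import structures.
From mathcomp Require Import all_boot all_order all_algebra.
From mathcomp Require Import all_classical all_reals all_analysis.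
Set Implicit Arguments.
Unset Strict Implicit.
Unset Printing Implicit Defensive.
Import Order.TTheory GRing.Theory Num.Theory.
Local Open Scope classical_set_scope.
Local Open Scope ring_scope.

Definition h_integrand (R : realType) (rho nu u : R) : R :=
  rho / (1 - rho) * (rho * u / (1 - rho)) `^ (nu - 1)
    * (1 - u) `^ (1 / (1 - rho))
  + (1 + rho * u / (1 - rho)) `^ nu * (1 - u) `^ (1 / (1 - rho) - 1).

(* The integrand is nonnegative on [0, 1] when 0 <= rho < 1, so its integral
   always makes sense in \bar R; keeping h there (instead of applying fine)
   means that a bound such as h rho nu < 1 cannot hold because of an infinite
   integral being sent to 0.  At rho = 0 the integrand is constantly 1 and
   h 0 nu = 1, so the strict bound can only hold for rho > 0. *)
Definition h (R : realType) (rho nu : R) : \bar R :=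
  (\int[lebesgue_measure]_(u in `[0%R, 1%R]) (h_integrand rho nu u)%:E)%E.

(* Main.v *)
Require Import Defs.
From HB Require Import structures.
From mathcomp Require Import all_boot all_order all_algebra.
From mathcomp Require Import all_classical all_reals all_analysis.
From mathcomp Require Import measurable_realfun ring lra.
Set Implicit Arguments.
Unset Strict Implicit.
Unset Printing Implicit Defensive.
Import Order.TTheory GRing.Theory Num.Theory.
Import numFieldNormedType.Exports.
Local Open Scope classical_set_scope.
Local Open Scope ring_scope.

(** Put c = rho / (1 - rho), so that 1 / (1 - rho) = c + 1, and
    th = nu - 1, which lies in ]0, 1[.  The integrand becomes
      c (c u)^th (1 - u)^(c + 1) + (1 + c u)^(1 + th) (1 - u)^c.
    For fixed u in ]0, 1[ it is a sum of exponentials in th, hence convex.  At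
    th = 0 and at th = 1 it is a polynomial in u times powers of 1 - u, and in
    both cases its integral is exactly 1.  Convexity in th therefore gives
    h <= 1, and only strictness needs an extra argument.

    Strictness is obtained without discussing null sets.  Convexity in th is
    used in the form of the tangent inequality
      t^th <= s^th (1 - th + th t / s)      (powR_le_tangent),
    with s = 1 for t = c u, but with a constant s different from 1 for
    t = 1 + c u.  Let I1 and I2 be the integrals over [0, 1] of
    (1 + c u) (1 - u)^c and of (1 + c u)^2 (1 - u)^c, that is
      I1 = 2 / (c + 2)   and   I2 = (5 c + 6) / ((c + 2) (c + 3)).
    For s = I2 / I1 the majorant of the second summand integrates to s^th I1
    = I1^(1 - th) I2^th (the bound that the Hoelder inequality would give),
    and the scalar inequality s^th < 1 - th + th s (powR_lt_tangent1) makes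
    this strictly smaller than (1 - th) I1 + th I2.  The latter is the value
    for which the total is 1.  The majorant is a combination of powers of
    1 - u, so its integral is elementary (integral_tangent_majorant). *)

(** * Tangent inequalities for powers *)

(** With L = 1 - th + th t, the numbers 1 / L and t / L have weighted mean 1
    for the weights 1 - th and th.  Applying 1 + x <= expR x at their logarithms
    shows that the weighted mean of these logarithms, th ln t - ln L, is at most
    0; the inequality is strict at ln (1 / L), which is nonzero as t != 1. *)
Lemma powR_lt_tangent1 (R : realType) (th t : R) :
  0 < th -> th < 1 -> 0 < t -> t != 1 -> t `^ th < 1 - th + th * t.
Proof.
move=> th0 th1 t0 t1.
set L := 1 - th + th * t.
have L0 : 0 < L by rewrite /L; nra.
have L1 : L^-1 != 1.
  rewrite invr_eq1 -subr_eq0 (_ : L - 1 = th * (t - 1)); last by rewrite /L; ring.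
  by rewrite mulf_eq0 subr_eq0 (gt_eqF th0).
have lnL1 : ln L^-1 != 0.
  apply: contra_neq L1 => e.
  by rewrite -[LHS]lnK ?posrE ?invr_gt0// e expR0.
have A := expR_gt1Dx lnL1.
have B := expR_ge1Dx (ln (t / L)).
rewrite lnK ?posrE ?invr_gt0// lnV ?posrE// in A.
rewrite lnK ?posrE ?divr_gt0// ln_div ?posrE// in B.
have E : (1 - th) * L^-1 + th * (t / L) = 1.
  by rewrite mulrA -mulrDl divff ?gt_eqF.
rewrite /powR gt_eqF// -[ltRHS]lnK ?posrE// ltr_expR.
nra.
Qed.

(** The graph of the concave function t |-> t^th lies below its tangent at s;
    this is the case s = 1 rescaled. *)
Lemma powR_le_tangent (R : realType) (th s t : R) :
  0 < th -> th < 1 -> 0 < s -> 0 <= t ->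
  t `^ th <= s `^ th * (1 - th + th * (t / s)).
Proof.
move=> th0 th1 s0 t0.
have {1}-> : t = s * (t / s) by rewrite mulrC divfK ?gt_eqF.
have ts0 : 0 <= t / s by exact: divr_ge0 t0 (ltW s0).
rewrite (powRM _ (ltW s0) ts0) ler_wpM2l ?powR_ge0//.
move: ts0; rewrite le_eqVlt => /predU1P[<-|ts0].
  by rewrite powR0 ?gt_eqF// mulr0 addr0 subr_ge0 ltW.
have [->|ts1] := eqVneq (t / s) 1; first by rewrite powR1; lra.
exact/ltW/powR_lt_tangent1.
Qed.

(** * Integrals of powers of 1 - u *)

Lemma is_derive_onem_powR (R : realType) (p u : R) : u < 1 ->
  is_derive u 1 (fun x : R => (1 - x) `^ p) (- (p * (1 - u) `^ (p - 1))).
Proof.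
move=> u1.
have v0 : 0 < 1 - u by rewrite subr_gt0.
have D := @is_derive1_powR R p (1 - u) v0.
have D1 : is_derive u 1 (fun x : R => 1 - x) (-1 : R).
  have := is_deriveB (is_derive_cst (1 : R) u 1) (is_derive_id u 1).
  by rewrite sub0r.
have := @is_derive1_comp R (fun x : R => x `^ p) (fun x : R => 1 - x) u _ _ D D1.
by rewrite mulrN1.
Qed.

(** At u = 1 the function u |-> (1 - u)^p is continuous from the left only,
    because a negative base has power 1. *)
Lemma onem_powR_continuous (R : realType) (p : R) : 0 < p ->
  {within `[0%R, 1%R], continuous (fun x : R => (1 - x) `^ p)}.
Proof.
move=> p0.
have C (u : R) : u < 1 -> {for u, continuous (fun x : R => (1 - x) `^ p)}.
  move=> u1; have [D _] := @is_derive_onem_powR R p u u1.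
  exact/differentiable_continuous/derivable1_diffP.
apply/(continuous_within_itvP _ ltr01); split.
- by move=> u; rewrite in_itv/= => /andP[_ /C].
- exact/cvg_at_right_filter/C.
- rewrite subrr powR0 ?gt_eqF//.
  apply: (@cvg_comp _ _ _ (fun x : R => 1 - x) (fun y : R => y `^ p) _ (0^'+)%R);
    last exact: powR_cvg0.
  move=> A [e /= e0 eA]; exists e => //= x /= xe x1.
  apply: eA; rewrite /= ?subr_gt0//.
  by rewrite sub0r normrN.
Qed.

Lemma integral_onem_powR (R : realType) (p : R) : 0 < p ->
  (\int[lebesgue_measure]_(u in `[0%R, 1%R]) ((1 - u) `^ p)%:E
    = (p + 1)^-1%:E)%E.
Proof.
move=> p0.
have p1 : p + 1 != 0 by rewrite gt_eqF// addr_gt0.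
have p10 : 0 < p + 1 by rewrite addr_gt0.
rewrite (@continuous_FTC2 R _ (fun x : R => - (p + 1)^-1 * (1 - x) `^ (p + 1)) 0 1 ltr01).
- rewrite subrr subr0 powR1 powR0// mulr0 mulr1 -EFinB; congr EFin; ring.
- exact: onem_powR_continuous.
- have := onem_powR_continuous p10.
  move/(continuous_within_itvP _ ltr01) => [_ c0 c1]; split.
  + move=> u; rewrite in_itv/= => /andP[_ u1].
    have [D _] := @is_derive_onem_powR R (p + 1) u u1.
    exact: derivableZ.
  + exact: cvgMr.
  + exact: cvgMr.
- move=> u; rewrite in_itv/= => /andP[_ u1].
  have [D DE] := @is_derive_onem_powR R (p + 1) u u1.
  rewrite derive1E deriveZ//= DE addrK; rewrite /GRing.scale/=.
  by rewrite mulrNN mulrA mulVf// mul1r.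
Qed.

Lemma integral_onem_powR3 (R : realType) (c a0 a1 a2 : R) : 0 < c ->
  (\int[lebesgue_measure]_(u in `[0%R, 1%R])
     (a0 * (1 - u) `^ c + a1 * (1 - u) `^ (c + 1)
      + a2 * (1 - u) `^ (c + 2))%:E
   = (a0 / (c + 1) + a1 / (c + 2) + a2 / (c + 3))%:E)%E.
Proof.
move=> c0.
have c1 : 0 < c + 1 by lra.
have c2 : 0 < c + 2 by lra.
have I (p : R) : 0 < p -> lebesgue_measure.-integrable `[0%R, 1%R]
    (fun u : R => ((1 - u) `^ p)%:E).
  move=> p0; apply: continuous_compact_integrable; first exact: segment_compact.
  exact: onem_powR_continuous.
have IZ (a p : R) : 0 < p -> lebesgue_measure.-integrable `[0%R, 1%R]
    (fun u : R => a%:E * ((1 - u) `^ p)%:E)%E.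
  by move=> p0; apply: integrableZl => //; exact: I.
have E (a p : R) : 0 < p ->
    (\int[lebesgue_measure]_(u in `[0%R, 1%R]) (a%:E * ((1 - u) `^ p)%:E)
      = (a / (p + 1))%:E)%E.
  by move=> p0; rewrite integralZl ?integral_onem_powR//; exact: I.
under eq_integral do rewrite !EFinD !EFinM.
rewrite integralD//=; [|by apply: integrableD => //; exact: IZ|exact: IZ].
rewrite integralD//=; [|exact: IZ|exact: IZ].
rewrite !E// -!EFinD; congr (_ / _ + _ / _ + _ / _)%:E; ring.
Qed.

(** * The majorant of the integrand *)

Lemma h_integrand_ge0 (R : realType) (rho nu u : R) :
  0 < rho -> rho < 1 -> 0 <= h_integrand rho nu u.
Proof.
move=> r0 r1; rewrite /h_integrand addr_ge0// mulr_ge0 ?powR_ge0//.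
by rewrite mulr_ge0 ?powR_ge0// ltW// divr_gt0// subr_gt0.
Qed.

Lemma measurable_fun_powR (R : realType) (f : R -> R) (p : R) :
  measurable_fun setT f -> measurable_fun setT (fun x => f x `^ p).
Proof. by move=> mf; apply: (measurableT_comp (measurable_powR p)). Qed.

Lemma measurable_h_integrand (R : realType) (rho nu : R) :
  measurable_fun setT (h_integrand rho nu).
Proof.
have mlin (a b : R) : measurable_fun setT (fun x : R => a * x / b).
  by apply: measurable_funM => //; exact: measurable_funM.
have m1 : measurable_fun setT (fun x : R => 1 - x) by exact: measurable_funB.
rewrite /h_integrand; apply: measurable_funD.
  apply: measurable_funM; last exact: measurable_fun_powR.
  by apply: measurable_funM => //; exact: measurable_fun_powR.
apply: measurable_funM; apply: measurable_fun_powR => //.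
exact: measurable_funD.
Qed.

(** The integrand with (c u)^th replaced by the tangent at 1 and (1 + c u)^th
    by the tangent at s. *)
Definition tangent_majorant (R : realType) (c th s u : R) : R :=
  c * (1 - th + th * (c * u)) * (1 - u) `^ (c + 1)
  + (1 + c * u) * (s `^ th * (1 - th + th * ((1 + c * u) / s))) * (1 - u) `^ c.

Lemma measurable_tangent_majorant (R : realType) (c th s : R) :
  measurable_fun setT (tangent_majorant c th s).
Proof.
have mpow p : measurable_fun setT (fun u : R => (1 - u) `^ p).
  by apply: measurable_fun_powR; exact: measurable_funB.
have mcu : measurable_fun setT (fun u : R => c * u) by exact: measurable_funM.
have mw : measurable_fun setT (fun u : R => 1 + c * u).
  exact: measurable_funD.
rewrite /tangent_majorant; apply: measurable_funD; apply: measurable_funM => //.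
  apply: measurable_funM => //; apply: measurable_funD => //.
  exact: measurable_funM.
apply: measurable_funM => //; apply: measurable_funM => //.
apply: measurable_funD => //; apply: measurable_funM => //.
exact: measurable_funM.
Qed.

Lemma powRD1 (R : realType) (x p : R) :
  0 <= x -> 0 < p -> x `^ (p + 1) = x * x `^ p.
Proof.
move=> x0 p0; rewrite -[in RHS](addrK 1 p) mulr_powRB1// addr_gt0//.
Qed.

Lemma h_integrand_le (R : realType) (c th s u : R) :
  0 < c -> 0 < th -> th < 1 -> 0 < s -> 0 <= u ->
  h_integrand (c / (1 + c)) (1 + th) u <= tangent_majorant c th s u.
Proof.
move=> c0 th0 th1 s0 u0.
have c1 : 1 + c != 0 by rewrite gt_eqF// addr_gt0.
have cu0 : 0 <= c * u by rewrite mulr_ge0// ltW.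
have E1 : 1 - c / (1 + c) = (1 + c)^-1 by field.
have E2 : c / (1 + c) * u / (1 - c / (1 + c)) = c * u by rewrite E1; field.
have E3 : c / (1 + c) / (1 - c / (1 + c)) = c by rewrite E1; field.
have E4 : 1 / (1 - c / (1 + c)) = c + 1 by rewrite E1; field.
rewrite /h_integrand E2 E3 E4 addrK (addrC 1 th) addrK.
rewrite (@powRD1 _ (1 + c * u))// ?addr_ge0//.
have L1 : (c * u) `^ th <= 1 - th + th * (c * u).
  have := powR_le_tangent th0 th1 ltr01 cu0.
  by rewrite powR1 mul1r divr1.
have L2 : (1 + c * u) `^ th <= s `^ th * (1 - th + th * ((1 + c * u) / s)).
  by apply: powR_le_tangent; rewrite ?addr_ge0.
apply: lerD; rewrite ler_wpM2r ?powR_ge0// ler_wpM2l//; first exact: ltW.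
exact: addr_ge0.
Qed.

(** Substituting c u = c - c (1 - u) turns the majorant into a combination of
    (1 - u)^c, (1 - u)^(c + 1) and (1 - u)^(c + 2).  The value is grouped to
    display the integrals I1 = 2 / (c + 2) and
    I2 = (5 c + 6) / ((c + 2) (c + 3)) of (1 + c u) (1 - u)^c and
    (1 + c u)^2 (1 - u)^c. *)
Lemma integral_tangent_majorant (R : realType) (c th s : R) : 0 < c -> 0 < s ->
  (\int[lebesgue_measure]_(u in `[0%R, 1%R]) (tangent_majorant c th s u)%:E
   = ((1 - th) * (c / (c + 2)) + th * (c ^+ 2 / ((c + 2) * (c + 3)))
      + s `^ th * ((1 - th) * (2 / (c + 2))
         + th * ((5 * c + 6) / ((c + 2) * (c + 3)) / s)))%:E)%E.
Proof.
move=> c0 s0; set K := s `^ th.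
have s_neq0 : s != 0 by rewrite gt_eqF.
have [c1 c2 c3] : [/\ c + 1 != 0, c + 2 != 0 & c + 3 != 0].
  by split; rewrite gt_eqF//; lra.
transitivity (\int[lebesgue_measure]_(u in `[0%R, 1%R])
    (((1 - th) * K * (1 + c) + th * (K / s) * (1 + c) ^+ 2) * (1 - u) `^ c
     + (c * (1 - th + th * c) - (1 - th) * K * c
        - 2 * th * (K / s) * c * (1 + c)) * (1 - u) `^ (c + 1)
     + (th * (K / s) * c ^+ 2 - th * c ^+ 2) * (1 - u) `^ (c + 2))%:E)%E.
  apply: eq_integral => u; rewrite inE/= in_itv/= => /andP[_ u1].
  have v0 : 0 <= 1 - u by rewrite subr_ge0.
  rewrite /tangent_majorant -/K (_ : c + 2 = c + 1 + 1); last ring.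
  rewrite !powRD1// ?addr_gt0//; congr EFin; field.
  exact: s_neq0.
rewrite integral_onem_powR3//; congr EFin; field.
by rewrite c1 c2 c3 s_neq0.
Qed.

(** * The strict bound *)

Theorem mainTheorem5 (R : realType) (rho nu : R)
  (hnu1 : 1 < nu) (hnu2 : nu < 2) (hrho0 : 0 < rho) (hrho1 : rho < 1) :
  (h rho nu < 1)%E.
Proof.
set c := rho / (1 - rho); set th := nu - 1.
have r1 : 0 < 1 - rho by rewrite subr_gt0.
have c0 : 0 < c by exact: divr_gt0.
have th0 : 0 < th by rewrite /th; lra.
have th1 : th < 1 by rewrite /th; lra.
have c2 : c + 2 != 0 by lra.
have c3 : c + 3 != 0 by lra.
(* s = I2 / I1, the point of tangency that minimizes the integrated majorant. *)
pose s := (5 * c + 6) / (2 * (c + 3)).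
have s0 : 0 < s by rewrite divr_gt0//; lra.
have s1 : s != 1.
  rewrite gt_eqF// /s ltr_pdivlMr; lra.
have -> : rho = c / (1 + c).
  rewrite /c; field; lra.
have -> : nu = 1 + th by rewrite /th; ring.
have K1 := powR_lt_tangent1 th0 th1 s0 s1.
rewrite /h; apply: (@le_lt_trans _ _ (\int[lebesgue_measure]_(u in `[0%R, 1%R])
   (tangent_majorant c th s u)%:E)%E).
  apply: ge0_le_integral; first exact: measurable_itv.
  - move=> u _; rewrite lee_fin.
    apply: h_integrand_ge0; first by rewrite divr_gt0// addr_gt0.
    by rewrite ltr_pdivrMr ?addr_gt0// mul1r ltrDr.
  - apply/measurable_EFinP; apply: measurable_funTS.
    exact: measurable_h_integrand.
  - apply/measurable_EFinP; apply: measurable_funTS.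
    exact: measurable_tangent_majorant.
  - move=> u /=; rewrite in_itv/= lee_fin => /andP[u0 _].
    exact: h_integrand_le.
rewrite integral_tangent_majorant// lte_fin.
have -> : (5 * c + 6) / ((c + 2) * (c + 3)) / s = 2 / (c + 2).
  by rewrite /s; field; rewrite c2 c3/=; lra.
rewrite -mulrDl subrK mul1r.
have K2 : s `^ th * (2 / (c + 2)) < (1 - th + th * s) * (2 / (c + 2)).
  by rewrite ltr_pM2r// divr_gt0//; lra.
(* (1 - th) times the value of h at nu = 1 plus th times its value at nu = 2,
   both of which are 1. *)
have E : (1 - th) * (c / (c + 2)) + th * (c ^+ 2 / ((c + 2) * (c + 3)))
    + (1 - th + th * s) * (2 / (c + 2)) = 1.
  by rewrite /s; field; rewrite c2 c3.
by rewrite -[ltRHS]E ltrD2l.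
Qed.
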